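(* Let $B$ be a topological space, let $X$, $Y$ be fibrewise spaces over $B$, and let $f,g:X\to Y$ be fibrewise maps. Let $\widetilde{\Pi}_Y:\mathcal{P}_B(f,g)\to X$ be the pullback of $\Pi_Y:P_B(Y)\to Y\times_B Y$ along $(f,g):X\to Y\times_B Y$. Then $$D_B(f,g)=\mathrm{secat}_B(\widetilde{\Pi}_Y).$$
   Context: Fix a topological space $B$ and let $I=[0,1]$. A fibrewise space over $B$ is a topological space $X$ with a continuous map $p_X:X\to B$; a fibrewise map $f:X\to Y$ is a continuous map with $p_Y\circ f=p_X$. A subspace $U\subset X$ is a fibrewise space via $p_X|_U$. Two fibrewise maps $f,g:X\to Y$ are fibrewise homotopic, $f\simeq_B g$, if there is a continuous $H:X\times I\to Y$ with $H(x,0)=f(x)$, $H(x,1)=g(x)$ and $p_Y(H(x,t))=p_X(x)$ for all $x,t$. The fibrewise product is $X\times_B Y=\{(x,y)\in X\times Y: p_X(x)=p_Y(y)\}$. Parametrized homotopic distance: $D_B(f,g)$ is the smallest integer $n\ge 0$ such that $X$ has an open cover $\{U_0,\dots,U_n\}$ with $f|_{U_i}\simeq_B g|_{U_i}$ for all $i$; it is $\infty$ if no such $n$ exists. Fibrewise sectional category: for a fibrewise map $q:E\to X$, $\mathrm{secat}_B(q)$ is the smallest integer $n\ge 0$ such that $X$ has an open cover $\{U_0,\dots,U_n\}$ together with fibrewise maps $s_i:U_i\to E$ satisfying $q\circ s_i\simeq_B \mathrm{inc}_{U_i}$ (the inclusion $U_i\hookrightarrow X$) for all $i$; it is $\infty$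 if no such $n$ exists. Fibrewise path space: $P_B(Y)=\{(b,\alpha)\in B\times Y^I : p_Y\circ\alpha \text{ is the constant path at } b\}$, where $Y^I$ has the compact-open topology, with projection $(b,\alpha)\mapsto b$; and $\Pi_Y:P_B(Y)\to Y\times_B Y$, $\Pi_Y(b,\alpha)=(\alpha(0),\alpha(1))$. The pullback is $\mathcal{P}_B(f,g)=\{(x,(b,\alpha))\in X\times P_B(Y): \alpha(0)=f(x),\ \alpha(1)=g(x)\}$ and $\widetilde{\Pi}_Y(x,(b,\alpha))=x$. *)

(* Defs.v *)
From HB Require Import structures.
From mathcomp Require Import all_boot all_order all_algebra.
From mathcomp Require Import all_classical all_reals all_analysis.

Set Implicit Arguments.
Unset Strict Implicit.
Unset Printing Implicit Defensive.

Import Order.TTheory GRing.Theory Num.Theory.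
Import numFieldNormedType.Exports.

Local Open Scope classical_set_scope.
Local Open Scope ring_scope.

(* Gives [continuousType I Y] the compact-open topology. *)
Import ArrowAsCompactOpen.

(* [+oo] when no natural number satisfies [P]; [-oo] is never taken. *)
Definition least (P : nat -> Prop) : \bar nat :=
  match pselect (exists n, `[< P n >]) with
  | left exP => EFin (ex_minn exP)
  | right _ => +oo%E
  end.

Lemma least_EFin (P : nat -> Prop) (n : nat) :
  least P = EFin n <-> P n /\ forall m, P m -> (n <= m)%N.
Proof.
rewrite /least; case: pselect => [exP|nP]; last first.
  by split=> // -[Pn _]; case: nP; exists n; apply/asboolP.
case: ex_minnP => k /asboolP Pk kmin; split=> [[<-]|[Pn nmin]].
  by split=> // m Pm; apply: kmin; apply/asboolP.
congr EFin; apply/eqP; rewrite eqn_leq nmin // andbT.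
by apply: kmin; apply/asboolP.
Qed.

Lemma least_pinfty (P : nat -> Prop) :
  least P = +oo%E <-> forall n, ~ P n.
Proof.
rewrite /least; case: pselect => [exP|nP]; split=> //.
- by move=> nP; have [n /asboolP Pn] := exP; case: (nP n).
- by move=> _ n Pn; apply: nP; exists n; apply/asboolP.
Qed.

Definition unit_itv (R : realType) : set R := `[0, 1].
Arguments unit_itv : clear implicits.

Lemma unit_itv0 (R : realType) : (0 : R) \in unit_itv R.
Proof. by rewrite inE /unit_itv /= in_itv /= lexx ler01. Qed.

Lemma unit_itv1 (R : realType) : (1 : R) \in unit_itv R.
Proof. by rewrite inE /unit_itv /= in_itv /= lexx ler01. Qed.

Definition I0 (R : realType) : unit_itv R := exist _ 0 (unit_itv0 R).
Definition I1 (R : realType) : unit_itv R := exist _ 1 (unit_itv1 R).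

Record fibrewise (B : topologicalType) := Fibrewise {
  fw_sort :> topologicalType;
  fw_proj : fw_sort -> B;
  fw_proj_cts : continuous fw_proj
}.
Arguments fw_proj {B} f : rename.

Record fibrewise_map (B : topologicalType) (X Y : fibrewise B) := FibrewiseMap {
  fw_fun :> X -> Y;
  fw_fun_cts : continuous fw_fun;
  fw_funE : fw_proj Y \o fw_fun =1 fw_proj X
}.

Definition fw_homotopic (R : realType) (B : topologicalType)
    (X Y : fibrewise B) (f g : fibrewise_map X Y) : Prop :=
  exists H : X * unit_itv R -> Y,
    [/\ continuous H,
        forall x, H (x, I0 R) = f x,
        forall x, H (x, I1 R) = g x &
        forall x t, fw_proj Y (H (x, t)) = fw_proj X x].

Section composition.
Context (B : topologicalType) (X Y Z : fibrewise B).
Context (g : fibrewise_map Y Z) (f : fibrewise_map X Y).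

Lemma fw_comp_cts : continuous (g \o f).
Proof.
by move=> x; apply: continuous_comp; [exact: fw_fun_cts|exact: fw_fun_cts].
Qed.

Lemma fw_compE : fw_proj Z \o (g \o f) =1 fw_proj X.
Proof. by move=> x; exact: etrans (fw_funE g (f x)) (fw_funE f x). Qed.

Definition fw_comp : fibrewise_map X Z := FibrewiseMap fw_comp_cts fw_compE.
End composition.

Section subspace.
Context (B : topologicalType) (X : fibrewise B) (A : set X).

Lemma fw_inc_cts : continuous (\val : A -> X).
Proof. exact: (@initial_continuous A X set_val). Qed.

Lemma fw_sub_proj_cts : continuous (fw_proj X \o (\val : A -> X)).
Proof.
by move=> x; apply: continuous_comp; [exact: fw_inc_cts|exact: fw_proj_cts].
Qed.

Definition fw_sub : fibrewise B := Fibrewise fw_sub_proj_cts.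

Definition fw_inc : fibrewise_map fw_sub X :=
  @FibrewiseMap B fw_sub X \val fw_inc_cts (fun=> erefl).
End subspace.

Definition fw_restrict (B : topologicalType) (X Y : fibrewise B)
    (f : fibrewise_map X Y) (U : set X) : fibrewise_map (fw_sub U) Y :=
  fw_comp f (fw_inc U).

Definition open_cover (X : topologicalType) (n : nat)
    (U : 'I_n.+1 -> set X) : Prop :=
  (forall i, open (U i)) /\ \bigcup_i U i = setT.

Definition fw_homotopic_dist (R : realType) (B : topologicalType) (X Y : fibrewise B)
    (f g : fibrewise_map X Y) : \bar nat :=
  least (fun n => exists2 U : 'I_n.+1 -> set X, open_cover U &
    forall i, fw_homotopic R (fw_restrict f (U i)) (fw_restrict g (U i))).

Definition fw_secat (R : realType) (B : topologicalType) (E X : fibrewise B)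
    (q : fibrewise_map E X) : \bar nat :=
  least (fun n => exists2 U : 'I_n.+1 -> set X, open_cover U &
    forall i, exists s : fibrewise_map (fw_sub (U i)) E,
      fw_homotopic R (fw_comp q s) (fw_inc (U i))).

Section constructions.
Context (B : topologicalType).

Definition fw_base : fibrewise B :=
  @Fibrewise B B idfun (fun x => @cvg_id _ (nbhs x)).

Lemma fw_times_proj_cts (X : fibrewise B) (F : topologicalType) :
  continuous (fw_proj X \o (fst : X * F -> X)).
Proof.
by move=> z; apply: continuous_comp; [exact: cvg_fst|exact: fw_proj_cts].
Qed.

(* The product X * F, over B through its first factor only. *)
Definition fw_times (X : fibrewise B) (F : topologicalType) : fibrewise B :=
  Fibrewise (@fw_times_proj_cts X F).

Definition fw_prod (X Y : fibrewise B) : fibrewise B :=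
  @fw_sub B (fw_times X Y) [set z | fw_proj X z.1 = fw_proj Y z.2].

Definition fw_pullback (E X Z : fibrewise B) (q : fibrewise_map E Z)
    (h : fibrewise_map X Z) : fibrewise B :=
  @fw_sub B (fw_times X E) [set z | h z.1 = q z.2].

Lemma fw_pullback_proj_cts (E X Z : fibrewise B) (q : fibrewise_map E Z)
    (h : fibrewise_map X Z) :
  continuous (fun z : fw_pullback q h => (\val z).1).
Proof.
move=> z; apply: (@continuous_comp (fw_pullback q h) (fw_times X E) X \val fst);
  last exact: cvg_fst.
exact: (@fw_inc_cts B (fw_times X E)).
Qed.

Definition fw_pullback_proj (E X Z : fibrewise B) (q : fibrewise_map E Z)
    (h : fibrewise_map X Z) : fibrewise_map (fw_pullback q h) X :=
  FibrewiseMap (@fw_pullback_proj_cts E X Z q h) (fun=> erefl).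

Section pairing.
Context (X Y1 Y2 : fibrewise B).
Context (f : fibrewise_map X Y1) (g : fibrewise_map X Y2).

Lemma fw_pair_subproof (x : X) :
  (f x, g x) \in [set z : Y1 * Y2 | fw_proj Y1 z.1 = fw_proj Y2 z.2].
Proof. by apply: mem_set => /=; rewrite [LHS](fw_funE f) -(fw_funE g). Qed.

Definition fw_pair_fun (x : X) : fw_prod Y1 Y2 :=
  exist _ (f x, g x) (fw_pair_subproof x).

Lemma fw_pair_cts : continuous fw_pair_fun.
Proof.
apply: continuous_comp_initial => x.
by apply: cvg_pair => /=; exact: fw_fun_cts.
Qed.

Definition fw_pair : fibrewise_map X (fw_prod Y1 Y2) :=
  FibrewiseMap fw_pair_cts (fw_funE f).
End pairing.

End constructions.

Section path_space.
Context (R : realType) (B : topologicalType) (Y : fibrewise B).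

Definition fw_path : fibrewise B :=
  @fw_sub B (fw_times (fw_base B) (continuousType (unit_itv R) Y))
    [set z : B * continuousType (unit_itv R) Y |
      forall t, fw_proj Y (z.2 t) = z.1].

Lemma path_eval_cts (t : unit_itv R) :
  continuous (fun a : continuousType (unit_itv R) Y => a t).
Proof.
apply/continuousP => O oO.
exists [set h : {compact-open, unit_itv R -> Y} | h @` [set t] `<=` O].
  by apply: compact_open_open => //; exact: compact_set1.
by apply/seteqP; split=> a /= => [|? _ [_ -> <-] //]; apply; exists t.
Qed.

Lemma fw_path_eval_cts (t : unit_itv R) :
  continuous (fun z : fw_path => (\val z).2 t).
Proof.
move=> z; apply: (@continuous_comp fw_path
  (fw_times (fw_base B) (continuousType (unit_itv R) Y)) Y \val
  (fun w => w.2 t)); first exact: fw_inc_cts.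
apply: (@continuous_comp (B * continuousType (unit_itv R) Y)%type
  (continuousType (unit_itv R) Y) Y snd (fun a => a t)); first exact: cvg_snd.
exact: path_eval_cts.
Qed.

Lemma fw_path_evalE (t : unit_itv R) :
  fw_proj Y \o (fun z : fw_path => (\val z).2 t) =1 fw_proj fw_path.
Proof. by move=> [z zP]; exact: (set_mem zP t). Qed.

Definition fw_path_eval (t : unit_itv R) : fibrewise_map fw_path Y :=
  FibrewiseMap (@fw_path_eval_cts t) (@fw_path_evalE t).

Definition fw_Pi : fibrewise_map fw_path (fw_prod Y Y) :=
  fw_pair (fw_path_eval (I0 R)) (fw_path_eval (I1 R)).

End path_space.

Section pullback_of_paths.
Context (R : realType) (B : topologicalType) (X Y : fibrewise B).
Context (f g : fibrewise_map X Y).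

Definition fw_path_pullback : fibrewise B :=
  fw_pullback (fw_Pi R Y) (fw_pair f g).

Definition fw_Pi_tilde : fibrewise_map fw_path_pullback X :=
  fw_pullback_proj (fw_Pi R Y) (fw_pair f g).

(* Spells out the defining condition of [fw_path_pullback] on pairs (x, z)
   with z = (b, alpha). *)
Lemma fw_path_pullbackP (x : X) (z : fw_path R Y) :
  fw_pair f g x = fw_Pi R Y z <->
  (\val z).2 (I0 R) = f x /\ (\val z).2 (I1 R) = g x.
Proof.
split=> [/(congr1 \val) /= [-> ->] //|[z0 z1]].
by apply: val_inj; rewrite /= z0 z1.
Qed.
End pullback_of_paths.

(* Main.v *)
Require Import Defs.
From mathcomp Require Import all_boot all_order all_algebra.
From mathcomp Require Import all_classical all_reals all_analysis.
From mathcomp Require Import lra.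

(** A fibrewise homotopy from [f \o u] to [g \o u], for a fibrewise map
    [u : W -> X], amounts by the exponential law to a continuous family of
    vertical paths in [Y], the path at [w] running from [f (u w)] to
    [g (u w)]; that is, to a strict lift of [u] through the pulled-back path
    fibration [q : P_B(f, g) -> X]. With [u] the inclusion of an open set [U],
    the homotopies counted by the homotopic distance are thus exactly the
    strict local sections of [q] ([fw_homotopic_lift]).

    The sectional category only asks for sections up to homotopy. To deal with
    these, note that evaluating paths is a tautological homotopy from [f \o q] to [g \o q] over the whole of
    [P_B(f, g)] ([fw_homotopic_path_pullback]), so a map [s] with [q \o s]
    homotopic to [u] gives the chain
    [f \o u ~ f \o q \o s ~ g \o q \o s ~ g \o u].
    Hence for each open set the two local conditions are equivalent
    ([fw_homotopic_secP]), the same covers are admissible on both sides, and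
    the two minima coincide.

    Currying a homotopy is always continuous; uncurrying, that is, the joint
    continuity of evaluation, rests on the unit interval being compact and
    regular. *)

Set Implicit Arguments.
Unset Strict Implicit.
Unset Printing Implicit Defensive.

Import Order.TTheory GRing.Theory Num.Theory.
Import numFieldNormedType.Exports.

Local Open Scope classical_set_scope.
Local Open Scope ring_scope.

Import ArrowAsCompactOpen.

Lemma eq_least (P Q : nat -> Prop) :
  (forall n, P n <-> Q n) -> least P = least Q.
Proof. by move=> PQ; congr least; apply/funext => n; exact/propext. Qed.

Lemma continuous_compT (X Y Z : topologicalType) (f : X -> Y) (g : Y -> Z) :
  continuous f -> continuous g -> continuous (g \o f).
Proof. by move=> fc gc x; apply: continuous_comp; [exact: fc|exact: gc]. Qed.

Lemma continuous_pair (X Y Z : topologicalType) (f : X -> Y) (g : X -> Z) :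
  continuous f -> continuous g -> continuous (fun x => (f x, g x)).
Proof. by move=> fc gc x; apply: cvg_pair => /=; [exact: fc|exact: gc]. Qed.

Lemma fst_cts (X Y : topologicalType) : continuous (@fst X Y).
Proof. by move=> x; exact: cvg_fst. Qed.

Lemma snd_cts (X Y : topologicalType) : continuous (@snd X Y).
Proof. by move=> x; exact: cvg_snd. Qed.

(** * The unit interval *)

Section unit_interval.
Context (R : realType).

Lemma clamp_subproof (t : R) : Num.min (Num.max 0 t) 1 \in unit_itv R.
Proof.
rewrite inE /unit_itv /= in_itv /= ge_min lexx orbT andbT.
by rewrite le_min ler01 le_max lexx.
Qed.

(** The retraction of the line onto the unit interval. It lets homotopies be
    reparametrized by real formulas such as [2 * t - 1], without proving that
    the values stay in the interval. *)
Definition clamp (t : R) : unit_itv R :=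
  exist _ (Num.min (Num.max 0 t) 1) (clamp_subproof t).

Lemma clamp_cts : continuous clamp.
Proof.
apply: continuous_comp_initial => t.
apply: (@min_fun_continuous _ R R (fun t : R => Num.max 0 t) (cst 1)).
  apply: (@max_fun_continuous _ R R (cst 0) id) => [x|x].
    exact: cvg_cst.
  exact: cvg_id.
by move=> x; exact: cvg_cst.
Qed.

Lemma clamp_val (t : unit_itv R) : clamp (\val t) = t.
Proof.
apply: val_inj => /=; case: t => t /=.
rewrite inE /unit_itv /= in_itv /= => /andP[t0 t1].
by rewrite max_r// min_l.
Qed.

Lemma clamp_le0 (t : R) : t <= 0 -> clamp t = I0 R.
Proof. by move=> t0; apply: val_inj; rewrite /= max_l// min_l. Qed.

Lemma clamp_ge1 (t : R) : 1 <= t -> clamp t = I1 R.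
Proof.
by move=> t1; apply: val_inj; rewrite /= max_r ?(le_trans ler01 t1)// min_r.
Qed.

(** The retraction presents the subspace as a continuous image of the segment,
    which is compact as a subset of the line. *)
Lemma unit_itv_compact : compact [set: unit_itv R].
Proof.
have <- : clamp @` `[0, 1] = [set: unit_itv R].
  apply/seteqP; split => // t _; exists (\val t); last exact: clamp_val.
  exact: set_mem (valP t).
apply: continuous_compact; last exact: segment_compact.
by apply: continuous_subspaceT; exact: clamp_cts.
Qed.

(** What makes evaluation of paths jointly continuous. *)
Lemma unit_itv_locally_compact : locally_compact [set: unit_itv R].
Proof.
move=> t _; exists setT; first exact: filterT.
by split; [exact: unit_itv_compact | exact: closedT].
Qed.

End unit_interval.

(** * Calculus of fibrewise homotopies *)

Section homotopies.
Context (R : realType) (B : topologicalType).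

Lemma eq_fw_homotopic (X Y : fibrewise B) (f g : fibrewise_map X Y) :
  f =1 g -> fw_homotopic R f g.
Proof.
move=> fg; exists (f \o fst); split => //= [|x t]; last exact: fw_funE.
by apply: continuous_compT (@fst_cts _ _) _; exact: fw_fun_cts.
Qed.

Lemma time_cts (X : topologicalType) :
  continuous (fun z : X * unit_itv R => set_val z.2 : R).
Proof.
apply: (@continuous_compT _ _ R snd set_val); first exact: snd_cts.
exact: initial_continuous.
Qed.

Lemma homotopy_reparam_cts (X Y : topologicalType) (H : X * unit_itv R -> Y)
    (phi : R -> R) :
  continuous H -> continuous phi ->
  continuous (fun z : X * unit_itv R => H (z.1, clamp (phi (\val z.2)))).
Proof.
move=> Hc phic.
apply: (@continuous_compT _ _ _
  (fun z : X * unit_itv R => (z.1, clamp (phi (\val z.2))))); last exact: Hc.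
apply: continuous_pair; first exact: fst_cts.
apply: (@continuous_compT _ _ _ _ (clamp (R := R) \o phi)).
  exact: time_cts.
by apply: continuous_compT; [exact: phic|exact: clamp_cts].
Qed.

Lemma fw_homotopic_sym (X Y : fibrewise B) (f g : fibrewise_map X Y) :
  fw_homotopic R f g -> fw_homotopic R g f.
Proof.
move=> [H [Hc H0 H1 Hp]].
exists (fun z => H (z.1, clamp (1 - \val z.2))); split => [|x|x|x t] //=.
- apply: (@homotopy_reparam_cts _ _ H (fun t => 1 - t)) => // t.
  by apply: cvgB; [exact: cvg_cst|exact: cvg_id].
- by rewrite subr0 clamp_ge1.
- by rewrite subrr clamp_le0.
Qed.

Lemma half_time_closed (X : topologicalType) :
  closed [set z : X * unit_itv R | \val z.2 <= 2^-1] /\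
  closed [set z : X * unit_itv R | 2^-1 <= \val z.2].
Proof.
have valc := @time_cts X.
split.
  by apply: (@preimage_closed _ _ _ [set t : R | t <= 2^-1]) => //;
    exact: closed_le.
by apply: (@preimage_closed _ _ _ [set t : R | 2^-1 <= t]) => //;
  exact: closed_ge.
Qed.

(** Both halves are total functions thanks to [clamp], so each is continuous on
    the whole cylinder, and the concatenation is continuous by pasting along
    the closed halves. *)
Lemma fw_homotopic_trans (X Y : fibrewise B) (f g h : fibrewise_map X Y) :
  fw_homotopic R f g -> fw_homotopic R g h -> fw_homotopic R f h.
Proof.
move=> [H [Hc H0 H1 Hp]] [K [Kc K0 K1 Kp]].
pose F (z : X * unit_itv R) := H (z.1, clamp (2 * \val z.2)).
pose G (z : X * unit_itv R) := K (z.1, clamp (2 * \val z.2 - 1)).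
pose FG z := if \val z.2 <= 2^-1 then F z else G z.
have FGl z : \val z.2 <= 2^-1 -> F z = FG z by rewrite /FG => ->.
have FGr z : 2^-1 <= \val z.2 -> G z = FG z.
  rewrite /FG; case: ifPn => // zl zr.
  (* At time 1/2 the first homotopy ends where the second one starts. *)
  have z2 : \val z.2 = 2^-1 :> R by apply/eqP; rewrite eq_le zl.
  rewrite /F /G z2 divff ?pnatr_eq0// subrr.
  by rewrite clamp_le0// clamp_ge1// H1 K0.
exists FG; split => [|x|x|x t]; last 3 first.
- by rewrite -FGl /F /= ?mulr0 ?clamp_le0// invr_ge0 ler0n.
- by rewrite -FGr /G /= ?clamp_ge1//; lra.
- by rewrite /FG; case: ifP => _; rewrite ?Hp ?Kp.
have [cl cr] := half_time_closed X.
have two_cts : continuous (fun t : R => 2 * t).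
  by move=> t; apply: cvgM; [exact: cvg_cst|exact: cvg_id].
have Fc : continuous F by exact: homotopy_reparam_cts.
have Gc : continuous G.
  apply: (@homotopy_reparam_cts _ _ K (fun t => 2 * t - 1)) => // t.
  by apply: cvgB; [exact: two_cts|exact: cvg_cst].
apply/continuous_subspace_setT.
rewrite (_ : setT = [set z : X * unit_itv R | \val z.2 <= 2^-1] `|`
                    [set z : X * unit_itv R | 2^-1 <= \val z.2]); last first.
  by apply/esym/seteqP; split => // z _; exact/orP/le_total.
apply: withinU_continuous => //.
  apply: (@subspace_eq_continuous _ _ _ F); last exact: continuous_subspaceT.
  by move=> z /set_mem; exact: FGl.
apply: (@subspace_eq_continuous _ _ _ G); last exact: continuous_subspaceT.
by move=> z /set_mem; exact: FGr.
Qed.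

Lemma fw_homotopic_compl (X Y Z : fibrewise B) (h : fibrewise_map Y Z)
    (f g : fibrewise_map X Y) :
  fw_homotopic R f g -> fw_homotopic R (fw_comp h f) (fw_comp h g).
Proof.
move=> [H [Hc H0 H1 Hp]]; exists (h \o H); split => [z|x|x|x t] /=.
- by apply: continuous_comp; [exact: Hc|exact: fw_fun_cts].
- by rewrite H0.
- by rewrite H1.
- exact: etrans (fw_funE h _) (Hp x t).
Qed.

Lemma fw_homotopic_compr (X Y Z : fibrewise B) (h : fibrewise_map X Y)
    (f g : fibrewise_map Y Z) :
  fw_homotopic R f g -> fw_homotopic R (fw_comp f h) (fw_comp g h).
Proof.
move=> [H [Hc H0 H1 Hp]]; exists (fun z => H (h z.1, z.2)).
split => [z|x|x|x t] /=; rewrite ?H0 ?H1//; last first.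
  by rewrite Hp; exact: fw_funE.
apply: (@continuous_compT _ _ _ (fun z : X * unit_itv R => (h z.1, z.2)));
  last exact: Hc.
apply: continuous_pair; last exact: snd_cts.
by apply: (continuous_compT (@fst_cts _ _)); exact: fw_fun_cts.
Qed.

End homotopies.

(** * Homotopies as sections of the pulled-back path fibration *)

Section path_pullback.
Context (R : realType) (B : topologicalType) (X Y : fibrewise B).
Context (f g : fibrewise_map X Y).

Let q := fw_Pi_tilde R f g.

(** The tautological homotopy: at time [t], a point [(x, (b, alpha))] goes to
    [alpha t]. *)
Lemma fw_homotopic_path_pullback :
  fw_homotopic R (fw_comp f q) (fw_comp g q).
Proof.
pose path (w : fw_path_pullback R f g) := (\val (\val w).2).2.
have pathE w t : fw_proj Y (path w t) = fw_proj X (q w).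
  have zP := set_mem (valP (\val w).2).
  have [path0 _] := (@fw_path_pullbackP R B X Y f g _ _).1 (set_mem (valP w)).
  (* The path lies over the base point [b], which is identified with the base
     point of [x] by looking at time 0, where the path is at [f x]. *)
  rewrite [LHS](zP t) -(zP (I0 R)) [X in fw_proj Y X = _]path0.
  exact: fw_funE.
have path_cts : continuous path.
  apply: (@continuous_compT _ _ _
    (fun w : fw_path_pullback R f g => (\val w).2)
    (fun z : fw_path R Y => (\val z).2)).
    by apply: continuous_compT (@snd_cts _ _); exact: fw_inc_cts.
  by apply: continuous_compT (@snd_cts _ _); exact: fw_inc_cts.
exists (fun z => eval (path z.1, z.2)); split => [|w|w|w t].
- apply: (@continuous_compT _ _ _
    (fun z : fw_path_pullback R f g * unit_itv R => (path z.1, z.2)) eval).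
    apply: continuous_pair; last exact: snd_cts.
    by apply: continuous_compT path_cts; exact: fst_cts.
  apply: eval_continuous; first exact: unit_itv_locally_compact.
  exact: uniform_regular.
- by have [] := (@fw_path_pullbackP R B X Y f g _ _).1 (set_mem (valP w)).
- by have [] := (@fw_path_pullbackP R B X Y f g _ _).1 (set_mem (valP w)).
- exact: pathE.
Qed.

(** Currying the homotopy turns each point [w] into the vertical path
    [t |-> H (w, t)], and the lift is [w |-> (u w, (p w, H (w, -)))]. *)
Lemma fw_homotopic_lift (W : fibrewise B) (u : fibrewise_map W X) :
  fw_homotopic R (fw_comp f u) (fw_comp g u) ->
  exists s : fibrewise_map W (fw_path_pullback R f g), q \o s =1 u.
Proof.
move=> [H [Hc H0 H1 Hp]].
have [curryc pathc] := continuous_curry Hc.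
pose path w : continuousType (unit_itv R) Y := mkcts (pathc w).
have path_cts : continuous path by exact: continuous_comp_initial.
have path_fib w : (fw_proj W w, path w) \in
    [set z : B * continuousType (unit_itv R) Y |
      forall t, fw_proj Y (z.2 t) = z.1].
  by apply: mem_set => t; exact: Hp.
pose z w : fw_path R Y := exist _ (fw_proj W w, path w) (path_fib w).
have z_cts : continuous z.
  apply: continuous_comp_initial.
  by apply: (@continuous_pair _ _ _ (fw_proj W) path); first exact: fw_proj_cts.
have uz w : (u w, z w) \in
    [set v : X * fw_path R Y | fw_pair f g v.1 = fw_Pi R Y v.2].
  apply: mem_set; apply/fw_path_pullbackP; split.
    exact: H0.
  exact: H1.
pose s w : fw_path_pullback R f g := exist _ (u w, z w) (uz w).
have s_cts : continuous s.
  apply: continuous_comp_initial.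
  by apply: (@continuous_pair _ _ _ u z); first exact: fw_fun_cts.
by exists (@FibrewiseMap B W _ s s_cts (fw_funE u)).
Qed.

(** Forwards the lift is strict; backwards, the tautological homotopy is pulled
    back along [s] and corrected at both ends by the homotopy from [q \o s] to
    [u]. *)
Lemma fw_homotopic_secP (W : fibrewise B) (u : fibrewise_map W X) :
  fw_homotopic R (fw_comp f u) (fw_comp g u) <->
  exists s : fibrewise_map W (fw_path_pullback R f g),
    fw_homotopic R (fw_comp q s) u.
Proof.
split=> [/fw_homotopic_lift[s qs]|[s qs]].
  by exists s; exact: eq_fw_homotopic.
have fqs := fw_homotopic_compl f qs.
have gqs := fw_homotopic_compl g qs.
apply: fw_homotopic_trans (fw_homotopic_sym fqs) _.
apply: fw_homotopic_trans gqs.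
have [H HP] := fw_homotopic_compr s fw_homotopic_path_pullback.
(* The two bracketings of a triple composite agree as functions, but their
   continuity proofs differ; the homotopy itself serves for both. *)
by exists H.
Qed.

End path_pullback.

Theorem proposition3p4 (R : realType) (B : topologicalType)
  (X Y : fibrewise B) (f g : fibrewise_map X Y) :
  fw_homotopic_dist R f g = fw_secat R (fw_Pi_tilde R f g).
Proof.
apply: eq_least => n; split=> -[U Ucov fgU]; exists U => // i.
  exact: (fw_homotopic_secP R f g _).1 (fgU i).
exact: (fw_homotopic_secP R f g _).2 (fgU i).
Qed.
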